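(* Let $C,A_1,\dots,A_m$ be real symmetric $s\times s$ matrices and $b\in\mathbb{R}^m$. Consider the semidefinite program: minimize $\langle C,X\rangle$ subject to $\langle A_i,X\rangle=b_i$ for $i=1,\dots,m$, $X\in S_+^s$, with optimal value $\hat f_p$, and its dual: maximize $b^Ty$ subject to $C-\sum_{i=1}^my_iA_i\in S_+^s$, $y\in\mathbb{R}^m$, with optimal value $\hat f_d$. Assume that the dual boundedness qualification (DBQ) holds with bound $\overline{y}\in\mathbb{R}^m$. Let $\tilde X\in S_+^s$ and let $\overline{r}\in\mathbb{R}^m$ satisfy $$|\langle A_i,\tilde X\rangle-b_i|\le\overline{r}_i\quad\text{for }i=1,\dots,m.$$ Then: (a) The dual optimal value is bounded from above by $$\hat f_d\ \le\ \langle C,\tilde X\rangle+\overline{y}^T\overline{r}=:\overline{f}_d.$$ (b) If $\overline{r}=0$, then $\tilde X$ is primal feasible and $\hat f_p\le\overline{f}_d=\langle C,\tilde X\rangle$; if moreover $\tilde X$ is primal optimal, then $\hat f_p=\overline{f}_d$.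
   Context: $S_+^s$ is the cone of real symmetric positive semidefinite $s\times s$ matrices; $\langle X,Y\rangle=\mathrm{trace}(X^TY)$. In $\mathbb{R}^m$, absolute value and $\le$ are componentwise. $\hat f_p$ is the infimum of the primal objective ($+\infty$ if infeasible); $\hat f_d$ is the supremum of the dual objective ($-\infty$ if infeasible). DBQ (with bound $\overline{y}$): either (i) the dual problem is infeasible (in which case no condition is imposed on $\overline{y}$), or (ii) $\hat f_d$ is finite and for every $\varepsilon>0$ there exists a dual feasible $y(\varepsilon)$ with $|y(\varepsilon)|\le\overline{y}$ and $\hat f_d-b^Ty(\varepsilon)\le\varepsilon$. *)

(* Defs.v *)
From mathcomp Require Import all_boot all_order all_algebra.
From mathcomp Require Import all_classical all_reals all_analysis.

Set Implicit Arguments.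
Unset Strict Implicit.
Unset Printing Implicit Defensive.

Import Order.TTheory GRing.Theory Num.Theory.
Local Open Scope classical_set_scope.
Local Open Scope ring_scope.

Definition mxdot (R : realType) (p q : nat) (X Y : 'M[R]_(p, q)) : R :=
  \tr (X^T *m Y).

Definition dotv (R : realType) (m : nat) (u v : 'cV[R]_m) : R :=
  (u^T *m v) 0 0.

Definition psdmx (R : realType) (s : nat) : set 'M[R]_s :=
  [set X | X \is symmetricmx /\ forall v : 'cV[R]_s, 0 <= dotv v (X *m v)].

Section SemidefiniteProgram.
Variables (R : realType) (s m : nat).
Variables (C : 'M[R]_s) (A : 'I_m -> 'M[R]_s) (b : 'cV[R]_m).

Definition primal_feasible : set 'M[R]_s :=
  [set X | psdmx X /\ forall i, mxdot (A i) X = b i 0].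

(* [ereal_inf set0 = +oo] and [ereal_sup set0 = -oo] give the conventional
   values of infeasible programs. *)
Definition primal_value : \bar R :=
  ereal_inf [set (mxdot C X)%:E | X in primal_feasible].

Definition primal_optimal : set 'M[R]_s :=
  [set X | primal_feasible X /\
    forall Y, primal_feasible Y -> mxdot C X <= mxdot C Y].

Definition dual_feasible : set 'cV[R]_m :=
  [set y | psdmx (C - \sum_i y i 0 *: A i)].

Definition dual_value : \bar R :=
  ereal_sup [set (dotv b y)%:E | y in dual_feasible].

Definition DBQ (ybar : 'cV[R]_m) : Prop :=
  dual_feasible = set0 \/
  (dual_value \is a fin_num /\
   forall eps : R, 0 < eps ->
     exists y : 'cV[R]_m,
       [/\ dual_feasible y,
           forall i, `|y i 0| <= ybar i 0 &
           (dual_value - (dotv b y)%:E <= eps%:E)%E]).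

End SemidefiniteProgram.

(* Main.v *)
Require Import Defs.
From mathcomp Require Import all_boot all_order all_algebra.
From mathcomp Require Import all_classical all_reals all_analysis.
From mathcomp Require Import ring lra.

Set Implicit Arguments.
Unset Strict Implicit.
Unset Printing Implicit Defensive.

Import Order.TTheory GRing.Theory Num.Theory.
Local Open Scope classical_set_scope.
Local Open Scope ring_scope.

(** The bound is weak duality with a slack.  Pairing the dual slack matrix
    [C - \sum_i y_i A_i] with the positive semidefinite [Xt] gives a nonnegative
    number, that is
      [b^T y <= <C, Xt> - \sum_i y_i (<A_i, Xt> - b_i)].
    When [|y| <= ybar], the last sum is at least [- ybar^T rbar], so every dual
    feasible [y] in the box has an objective below [fbar]
    ([dual_objective_le]).  The qualification says that such [y] already
    approximate the dual value, so the bound passes to the supremum.  Part (b)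
    is immediate once the residuals vanish.

    The analytic content is the self-duality of the semidefinite cone:
    [<P, Q> >= 0] for positive semidefinite [P] and [Q] ([mxdot_psd_ge0]).
    Instead of diagonalising [P], the proof peels off rank-one terms: if
    [v^T P v > 0], subtracting [(P v) (P v)^T / (v^T P v)] leaves a positive
    semidefinite matrix of smaller rank ([psdmx_deflate],
    [rank_deflate]), and each removed term contributes a nonnegative multiple of
    [(P v)^T Q (P v)].  The process stops at a matrix whose quadratic form
    vanishes, which is zero by polarisation ([quad_eq0]). *)

Lemma dotvE (R : realType) (m : nat) (u v : 'cV[R]_m) :
  dotv u v = \sum_i u i 0 * v i 0.
Proof. by rewrite /dotv mxE; apply: eq_bigr => i _; rewrite mxE. Qed.

Lemma dotvC (R : realType) (m : nat) (u v : 'cV[R]_m) : dotv u v = dotv v u.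
Proof. by rewrite !dotvE; apply: eq_bigr => i _; rewrite mulrC. Qed.

Lemma dotvDl (R : realType) (m : nat) (u v w : 'cV[R]_m) :
  dotv (u + v) w = dotv u w + dotv v w.
Proof. by rewrite /dotv linearD mulmxDl mxE. Qed.

Lemma dotvZl (R : realType) (m : nat) (a : R) (u v : 'cV[R]_m) :
  dotv (a *: u) v = a * dotv u v.
Proof. by rewrite /dotv linearZ -scalemxAl mxE. Qed.

Lemma dotvDr (R : realType) (m : nat) (u v w : 'cV[R]_m) :
  dotv w (u + v) = dotv w u + dotv w v.
Proof. by rewrite ![dotv w _]dotvC dotvDl. Qed.

Lemma dotvZr (R : realType) (m : nat) (a : R) (u v : 'cV[R]_m) :
  dotv v (a *: u) = a * dotv v u.
Proof. by rewrite ![dotv v _]dotvC dotvZl. Qed.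

Lemma mxdotDl (R : realType) (p q : nat) (X Y Z : 'M[R]_(p, q)) :
  mxdot (X + Y) Z = mxdot X Z + mxdot Y Z.
Proof. by rewrite /mxdot linearD mulmxDl linearD. Qed.

Lemma mxdotZl (R : realType) (p q : nat) (a : R) (X Z : 'M[R]_(p, q)) :
  mxdot (a *: X) Z = a * mxdot X Z.
Proof. by rewrite /mxdot linearZ -scalemxAl linearZ. Qed.

Lemma mxdot0l (R : realType) (p q : nat) (Z : 'M[R]_(p, q)) : mxdot 0 Z = 0.
Proof. by rewrite -(scale0r 0) mxdotZl mul0r. Qed.

Lemma mxdot_suml (R : realType) (p q : nat) (I : finType)
    (F : I -> 'M[R]_(p, q)) (Z : 'M[R]_(p, q)) :
  mxdot (\sum_i F i) Z = \sum_i mxdot (F i) Z.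
Proof.
apply: (big_morph (fun X => mxdot X Z)) => [X Y|]; first exact: mxdotDl.
exact: mxdot0l.
Qed.

Lemma mxdot_rank1 (R : realType) (s : nat) (w : 'cV[R]_s) (Q : 'M[R]_s) :
  mxdot (w *m w^T) Q = dotv w (Q *m w).
Proof.
by rewrite /mxdot /dotv trmx_mul trmxK -mulmxA mxtrace_mulC trace_mx11 mulmxA.
Qed.

Lemma dotv_rank1 (R : realType) (s : nat) (u w : 'cV[R]_s) :
  dotv u (w *m w^T *m u) = dotv u w ^+ 2.
Proof.
by rewrite expr2 [X in _ * X]dotvC /dotv !mulmxA -mulmxA mxE big_ord1.
Qed.

Lemma symmetricmxP (R : realType) (s : nat) (P : 'M[R]_s) :
  P \is symmetricmx <-> P^T = P.
Proof.
rewrite is_hermitianmxE expr0 scale1r map_mx_id //.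
by split=> [/eqP {2}->|->].
Qed.

Lemma dotv_sym (R : realType) (s : nat) (P : 'M[R]_s) (u v : 'cV[R]_s) :
  P^T = P -> dotv u (P *m v) = dotv v (P *m u).
Proof. by move=> PT; rewrite dotvC /dotv trmx_mul PT mulmxA. Qed.

Lemma quadD (R : realType) (s : nat) (P : 'M[R]_s) (u v : 'cV[R]_s) (t : R) :
  P^T = P ->
  dotv (u + t *: v) (P *m (u + t *: v)) =
  dotv u (P *m u) + 2 * t * dotv u (P *m v) + t ^+ 2 * dotv v (P *m v).
Proof.
move=> PT; rewrite mulmxDr -scalemxAr dotvDl !dotvDr !dotvZl !dotvZr.
rewrite (dotv_sym v u) //; ring.
Qed.

(** Polarisation, applied to pairs of basis vectors: the bilinear form
    of a symmetric matrix is determined by its quadratic form. *)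
Lemma quad_eq0 (R : realType) (s : nat) (P : 'M[R]_s) :
  P^T = P -> (forall v, dotv v (P *m v) = 0) -> P = 0.
Proof.
move=> PT q0; apply/matrixP => i j; rewrite mxE.
have := quadD (delta_mx i 0) (delta_mx j 0) 1 PT.
rewrite !q0 => bij.
have -> : P i j = dotv (delta_mx i 0) (P *m delta_mx j 0).
  by rewrite -colE /dotv trmx_delta -rowE !mxE.
lra.
Qed.

(** One step of a Cholesky-type elimination along [v], in a form that does not
    refer to coordinates. *)
Definition deflate (R : realType) (s : nat) (P : 'M[R]_s) (v : 'cV[R]_s) :
    'M[R]_s :=
  P - (dotv v (P *m v))^-1 *: ((P *m v) *m (P *m v)^T).

Lemma trmx_deflate (R : realType) (s : nat) (P : 'M[R]_s) (v : 'cV[R]_s) :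
  P^T = P -> (deflate P v)^T = deflate P v.
Proof.
by move=> PT; rewrite /deflate linearB linearZ /= PT trmx_mul trmxK.
Qed.

(** This is the Cauchy-Schwarz inequality for the form of [P], obtained by
    evaluating the form at the component of [u] orthogonal to [v]. *)
Lemma psdmx_deflate (R : realType) (s : nat) (P : 'M[R]_s) (v : 'cV[R]_s) :
  psdmx P -> 0 < dotv v (P *m v) -> psdmx (deflate P v).
Proof.
move=> [/symmetricmxP PT P0] v0; split; first exact/symmetricmxP/trmx_deflate.
move=> u; set a := dotv v _ in v0 *.
have := P0 (u + (- (dotv u (P *m v) / a)) *: v).
rewrite quadD // -/a.
have -> : dotv u (deflate P v *m u) =
          dotv u (P *m u) - a^-1 * dotv u (P *m v) ^+ 2.
  rewrite /deflate -/a -scaleNr mulmxDl -scalemxAl dotvDr dotvZr mulNr.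
  congr (_ - _ * _).
  exact: dotv_rank1.
suff -> : dotv u (P *m u) - a^-1 * dotv u (P *m v) ^+ 2 =
  dotv u (P *m u) + 2 * - (dotv u (P *m v) / a) * dotv u (P *m v) +
  (- (dotv u (P *m v) / a)) ^+ 2 * a by [].
by field; rewrite gt_eqF.
Qed.

(** Deflation keeps the kernel of [P] and adds [v] to it. *)
Lemma rank_deflate (R : realType) (s : nat) (P : 'M[R]_s) (v : 'cV[R]_s) :
  P^T = P -> 0 < dotv v (P *m v) -> (\rank (deflate P v) < \rank P)%N.
Proof.
move=> PT v0; set a := dotv v _ in v0.
have lt_ker : (kermx P < kermx (deflate P v))%MS.
  rewrite ltmxE; apply/andP; split.
    apply/sub_kermxP.
    by rewrite /deflate mulmxBr -scalemxAr !mulmxA mulmx_ker !mul0mx scaler0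
               subr0.
  apply/negP => /(submx_trans _) sub_ker.
  have /sub_ker/sub_kermxP vP0 : (v^T <= kermx (deflate P v))%MS.
    apply/sub_kermxP; rewrite /deflate mulmxBr -scalemxAr -/a mulmxA.
    have -> : v^T *m (P *m v) = a%:M by rewrite [LHS]mx11_scalar.
    by rewrite mul_scalar_mx scalerA mulVf ?gt_eqF // scale1r trmx_mul PT subrr.
  by move: v0; rewrite /a /dotv mulmxA vP0 mul0mx mxE ltxx.
have := rank_ltmx lt_ker.
rewrite !mxrank_ker => lt_sub.
rewrite ltnNge; apply/negP => /(leq_sub2l s).
by rewrite leqNgt lt_sub.
Qed.

(** Self-duality of the semidefinite cone (one inclusion of Fejer's theorem),
    by induction on the rank of [P]. *)
Lemma mxdot_psd_ge0 (R : realType) (s : nat) (P Q : 'M[R]_s) :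
  psdmx P -> psdmx Q -> 0 <= mxdot P Q.
Proof.
move=> psdP psdQ.
have [n] := ubnP (\rank P); elim: n => // n IHn in P psdP *; move=> rkP.
have [PT P0] := psdP; move/symmetricmxP in PT.
have [[v v0]|Pneg] := pselect (exists v, 0 < dotv v (P *m v)).
  have -> : P = deflate P v
      + (dotv v (P *m v))^-1 *: ((P *m v) *m (P *m v)^T) by rewrite subrK.
  rewrite mxdotDl mxdotZl mxdot_rank1 addr_ge0 //.
    apply: IHn; first exact: psdmx_deflate.
    exact: leq_trans (rank_deflate PT v0) rkP.
  by rewrite mulr_ge0 ?invr_ge0 ?(ltW v0) //; case: psdQ => _; apply.
rewrite (quad_eq0 PT) ?mxdot0l // => v; apply/eqP.
rewrite eq_le P0 andbT leNgt; apply/negP => v0; apply: Pneg; by exists v.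
Qed.

(** Weak duality with a slack: each primal equation contributes the term
    [y_i (<A_i, X> - b_i)], which is at most [ybar_i rbar_i] in absolute
    value. *)
Lemma dual_objective_le (R : realType) (s m : nat)
    (C : 'M[R]_s) (A : 'I_m -> 'M[R]_s) (b ybar rbar y : 'cV[R]_m)
    (X : 'M[R]_s) :
  psdmx X -> (forall i, `|mxdot (A i) X - b i 0| <= rbar i 0) ->
  dual_feasible C A y -> (forall i, `|y i 0| <= ybar i 0) ->
  dotv b y <= mxdot C X + dotv ybar rbar.
Proof.
move=> psdX hr feas_y hy.
have := mxdot_psd_ge0 feas_y psdX.
rewrite mxdotDl -scaleN1r mxdotZl mulN1r mxdot_suml subr_ge0 => slack.
rewrite -lerBlDr; apply: le_trans slack; rewrite lerBlDr !dotvE -big_split /=.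
apply: ler_sum => i _; rewrite mxdotZl.
have -> : b i 0 * y i 0 =
  y i 0 * mxdot (A i) X + y i 0 * - (mxdot (A i) X - b i 0) by ring.
rewrite lerD2l (le_trans (ler_norm _)) // normrM normrN.
by rewrite ler_pM.
Qed.

Theorem corollary6p2 (R : realType) (s m : nat)
  (C : 'M[R]_s) (A : 'I_m -> 'M[R]_s) (b : 'cV[R]_m)
  (ybar rbar : 'cV[R]_m) (Xt : 'M[R]_s)
  (hC : C \is symmetricmx)
  (hA : forall i, A i \is symmetricmx)
  (hDBQ : DBQ C A b ybar)
  (hXt : psdmx Xt)
  (hr : forall i, `|mxdot (A i) Xt - b i 0| <= rbar i 0) :
  let fbar := mxdot C Xt + dotv ybar rbar in
  (dual_value C A b <= fbar%:E)%E /\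
  (rbar = 0 ->
     [/\ primal_feasible A b Xt,
         (primal_value C A b <= fbar%:E)%E,
         fbar = mxdot C Xt &
         primal_optimal C A b Xt -> primal_value C A b = fbar%:E]).
Proof.
move=> fbar; split.
  case: hDBQ => [infeas|[dfin approx]].
    by rewrite /dual_value infeas image_set0 ereal_sup0 leNye.
  move: dfin approx; case: (dual_value C A b) => // d _ approx.
  rewrite lee_fin; apply/ler_addgt0Pr => e /approx [y [feas_y hy]].
  rewrite -EFinB lee_fin lerBlDl => /le_trans; apply; rewrite lerD2r.
  exact: dual_objective_le hXt hr feas_y hy.
move=> r0.
have fbarE : fbar = mxdot C Xt.
  by rewrite /fbar r0 /dotv mulmx0 mxE addr0.
have feas : primal_feasible A b Xt.
  split=> // i; apply/eqP; rewrite -subr_eq0 -normr_le0.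
  by have := hr i; rewrite r0 mxE.
have value_le : (primal_value C A b <= fbar%:E)%E.
  by apply: ereal_inf_lbound; exists Xt; rewrite ?fbarE.
split=> // -[_ opt]; apply/eqP; rewrite eq_le value_le /=.
by apply: le_ereal_inf_tmp => _ [Y feasY <-]; rewrite fbarE lee_fin opt.
Qed.
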